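(* Let $K,n\ge 1$ be integers, let $\mu>0$, and let $Y=I_K\otimes\mathbf 1_n^\top\in\mathbb R^{K\times Kn}$. Consider the relaxed parametrized kernel ridge regression problem $$\inf_{A,\,k}\ \operatorname{tr}\bigl((Y-Ak)(Y-Ak)^\top\bigr)+\mu\,\operatorname{tr}\bigl(kA^\top A\bigr),$$ where $A$ ranges over $\mathbb R^{K\times Kn}$ and $k$ ranges over all symmetric positive semi-definite, entrywise non-negative matrices in $\mathbb R^{Kn\times Kn}$ with all diagonal entries equal to $1$. Then the unique optimal kernel matrix is $$k^*=I_K\otimes(\mathbf 1_n\mathbf 1_n^\top)=Y^\top Y;$$ that is, the infimum is attained at $k=k^*$ (for a suitable $A$), and every optimal pair $(A,k)$ has $k=k^*$.
   Context: $\mathbf 1_n$ is the all-ones column vector of length $n$, $I_K$ the $K\times K$ identity matrix, $\otimes$ the Kronecker product. There are $K$ classes with $n$ samples each, ordered by class, and $Y$ is the one-hot label matrix. $\mu$ is the ridge parameter. *)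

(* Defs.v *)
From mathcomp Require Import all_boot all_order all_algebra.
From mathcomp Require Import reals.
From mathcomp Require Export mxtens.

Set Implicit Arguments.
Unset Strict Implicit.
Unset Printing Implicit Defensive.

Import Order.TTheory GRing.Theory Num.Theory.
Local Open Scope ring_scope.

Definition ones (R : realType) (n : nat) : 'cV[R]_n := const_mx 1.

Definition psdmx (R : realType) (N : nat) (M : 'M[R]_N) : Prop :=
  M^T = M /\ forall x : 'cV[R]_N, 0 <= (x^T *m M *m x) 0 0.

(* The sample [j] of class [c] has index [mxtens_index (c, j) = c * n + j]; the
   cast only identifies the [K * 1] rows of the Kronecker product with [K]. *)
Definition labelmx (R : realType) (K n : nat) : 'M[R]_(K, K * n) :=
  castmx (muln1 K, erefl (K * n)%N) ((1%:M : 'M[R]_K) *t (ones R n)^T).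

Definition feasible_kernel (R : realType) (N : nat) (k : 'M[R]_N) : Prop :=
  [/\ psdmx k, forall i j, 0 <= k i j & forall i, k i i = 1].

Definition krr_objective (R : realType) (K N : nat) (mu : R)
    (Y A : 'M[R]_(K, N)) (k : 'M[R]_N) : R :=
  \tr ((Y - A *m k) *m (Y - A *m k)^T) + mu * \tr (k *m A^T *m A).

Definition krr_optimal (R : realType) (K N : nat) (mu : R)
    (Y A : 'M[R]_(K, N)) (k : 'M[R]_N) : Prop :=
  feasible_kernel k /\
  forall (A' : 'M[R]_(K, N)) (k' : 'M[R]_N), feasible_kernel k' ->
    krr_objective mu Y A k <= krr_objective mu Y A' k'.

Definition class_kernel (R : realType) (K n : nat) : 'M[R]_(K * n) :=
  (1%:M : 'M[R]_K) *t (ones R n *m (ones R n)^T).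

(* Main.v *)
(** Put [t = 1 / (n + mu)] and [S = t Y]. Completing squares, the objective is
    [|Y - A k - mu S|^2 + mu tr ((A - S) k (A - S)^T)] plus a quantity [L k]
    depending on [k] only through [- tr (k (Y^T Y))]. Feasible kernels have
    entries at most [1] and [Y^T Y] is a 0-1 matrix, so [Y^T Y] minimizes [L],
    and both squares vanish at [(S, Y^T Y)]. At any other optimum both squares
    vanish as well, which forces [Y k = n Y]; with the entries of [k] in [[0, 1]]
    this determines [k]. *)
Require Import Defs.
From mathcomp Require Import all_boot all_order all_algebra.
From mathcomp Require Import reals.
From mathcomp Require Import ring lra.

Import Order.TTheory GRing.Theory Num.Theory.
Local Open Scope ring_scope.

Lemma mxtraceB {R : pzRingType} {n : nat} (M L : 'M[R]_n) :
  \tr (M - L) = \tr M - \tr L.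
Proof. exact: raddfB. Qed.

Lemma mxtrace_mul_tr {R : comPzRingType} {m n : nat} (M : 'M[R]_(m, n)) :
  \tr (M *m M^T) = \sum_i \sum_j M i j ^+ 2.
Proof.
apply: eq_bigr => i _; rewrite mxE; apply: eq_bigr => j _.
by rewrite mxE expr2.
Qed.

Lemma mxtrace_mul_tr_ge0 {R : realDomainType} {m n : nat} (M : 'M[R]_(m, n)) :
  0 <= \tr (M *m M^T).
Proof.
by rewrite mxtrace_mul_tr; do 2!apply: sumr_ge0 => ? _; apply: sqr_ge0.
Qed.

Lemma mxtrace_mul_tr_eq0 {R : realDomainType} {m n : nat} (M : 'M[R]_(m, n)) :
  \tr (M *m M^T) = 0 -> M = 0.
Proof.
rewrite mxtrace_mul_tr => /eqP.
rewrite psumr_eq0 => [|i _]; last by apply: sumr_ge0 => j _; apply: sqr_ge0.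
move=> /allP M0; apply/matrixP => i j; rewrite mxE.
have := M0 i (mem_index_enum i); rewrite /= psumr_eq0 => [|l _]; last exact: sqr_ge0.
by move=> /allP/(_ j (mem_index_enum j)); rewrite /= sqrf_eq0 => /eqP.
Qed.

Section PositiveSemidefinite.
Context {R : realType} {N : nat} {k : 'M[R]_N}.
Hypothesis k_psd : psdmx k.

(** The double transpose makes the right-hand side literally the quadratic form of [psdmx], at a
    column vector. *)
Lemma psdmx_entry {m : nat} (M : 'M[R]_(m, N)) (i : 'I_m) :
  (M *m k *m M^T) i i = ((row i M)^T^T *m k *m (row i M)^T) 0 0.
Proof.
by rewrite trmxK rowE trmx_mul trmx_delta !mulmxA -2!(mulmxA (delta_mx 0 i)) -rowE -colE !mxE.
Qed.

Lemma psdmx_mxtrace_ge0 {m : nat} (M : 'M[R]_(m, N)) :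
  0 <= \tr (M *m k *m M^T).
Proof. by apply: sumr_ge0 => i _; rewrite psdmx_entry; apply: k_psd.2. Qed.

(** A zero of a nonnegative form is a minimum, so its first variation in the direction [M *m k]
    vanishes. This replaces an argument by a square root of [k]. *)
Lemma psdmx_mxtrace_eq0 {m : nat} (M : 'M[R]_(m, N)) :
  \tr (M *m k *m M^T) = 0 -> M *m k = 0.
Proof.
move=> M0; apply: mxtrace_mul_tr_eq0; apply/eqP; rewrite eq_le mxtrace_mul_tr_ge0 andbT leNgt.
apply/negP; set P := M *m k; set q := \tr (P *m P^T) => q_gt0.
have c_ge0 := psdmx_mxtrace_ge0 P; set c := \tr _ in c_ge0.
have kT : k^T = k := k_psd.1.
have Pt : P^T = k *m M^T by rewrite trmx_mul kT.
(* The form at [M - s P] equals [- 2 s q + s^2 c], negative for small [s > 0]. *)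
have form s : \tr ((M - s *: P) *m k *m (M - s *: P)^T) = s ^+ 2 * c - 2 * s * q.
  rewrite [(_ - _)^T]linearB /= [(_ *: _)^T]linearZ /= !mulmxBl !mulmxBr -!scalemxAl -!scalemxAr.
  rewrite !mxtraceB !mxtraceZ M0 -/c.
  have -> : \tr (P *m k *m M^T) = q by rewrite -mulmxA -Pt.
  rewrite -/P -/q; ring.
(* The [+ 1] keeps the quotient defined when [c = 0]. Since [s * c = q - s], the form becomes
   [- s * (q + s)]. *)
have := psdmx_mxtrace_ge0 (M - (q / (c + 1)) *: P); rewrite form.
set s := q / (c + 1).
have c1 : 0 < c + 1 by lra.
have s_gt0 : 0 < s by apply: divr_gt0.
have sc : s * (c + 1) = q by rewrite /s divfK // gt_eqF.
have -> : s ^+ 2 * c - 2 * s * q = - (s * (q + s)) by rewrite -sc; ring.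
by rewrite oppr_ge0 leNgt mulr_gt0 // addr_gt0.
Qed.

End PositiveSemidefinite.

(** The quadratic form at the difference of the basis vectors [i] and [j] is [2 - 2 * k i j]. *)
Lemma feasible_kernel_le1 {R : realType} {N : nat} {k : 'M[R]_N} :
  feasible_kernel k -> forall i j, k i j <= 1.
Proof.
move=> [[kT k_psd] _ k_diag] i j.
have kE a b : ((delta_mx a (0 : 'I_1))^T *m k *m delta_mx b (0 : 'I_1)) 0 0 = k a b.
  by rewrite trmx_delta -rowE -colE !mxE.
have k_sym : k j i = k i j by rewrite -[in LHS]kT mxE.
have := k_psd (delta_mx i 0 - delta_mx j 0).
rewrite [(_ - _)^T]linearB /= !mulmxBl !mulmxBr.
set a := _ *m _ *m _; set b := _ *m _ *m _; set c := _ *m _ *m _; set d := _ *m _ *m _.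
have -> : (a - b - (c - d)) 0 0 = a 0 0 - b 0 0 - (c 0 0 - d 0 0) by rewrite !mxE.
rewrite !kE !k_diag k_sym; lra.
Qed.

(** [S] is arbitrary and the last bracket is free of [A]: for positive semidefinite [k] and
    [mu > 0], each [S] gives a lower bound affine in [k]. *)
Lemma krr_objective_completed_square {R : realType} {K N : nat} (mu : R)
    (Y A S : 'M[R]_(K, N)) (k : 'M[R]_N) : k^T = k ->
  krr_objective mu Y A k =
    \tr ((Y - A *m k - mu *: S) *m (Y - A *m k - mu *: S)^T)
    + mu * \tr ((A - S) *m k *m (A - S)^T)
    + (2 * mu * \tr (Y *m S^T) - mu ^+ 2 * \tr (S *m S^T)
       - mu * \tr (S *m k *m S^T)).
Proof.
move=> kT; set P := A *m k; set F := Y - P.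
have trC (X Z : 'M[R]_(K, N)) : \tr (X *m Z^T) = \tr (Z *m X^T).
  by rewrite -mxtrace_tr trmx_mul trmxK.
have -> : \tr ((F - mu *: S) *m (F - mu *: S)^T) =
    \tr (F *m F^T) - 2 * mu * \tr (F *m S^T) + mu ^+ 2 * \tr (S *m S^T).
  move: F => F.
  rewrite [(_ - _)^T]linearB /= [(_ *: _)^T]linearZ /= !mulmxBl !mulmxBr -!scalemxAl -!scalemxAr.
  rewrite !mxtraceB !mxtraceZ (trC S F); ring.
have -> : \tr ((A - S) *m k *m (A - S)^T) =
    \tr (P *m A^T) - 2 * \tr (P *m S^T) + \tr (S *m k *m S^T).
  have SkA : \tr (S *m k *m A^T) = \tr (P *m S^T).
    by rewrite (trC P) /P trmx_mul kT mulmxA.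
  rewrite [(_ - _)^T]linearB /= !mulmxBl !mulmxBr -/P.
  rewrite !mxtraceB SkA; ring.
have FS : \tr (F *m S^T) = \tr (Y *m S^T) - \tr (P *m S^T).
  by rewrite mulmxBl mxtraceB.
rewrite /krr_objective -/P -/F FS (mxtrace_mulC _ A) mulmxA -/P; ring.
Qed.

Section Labels.
Variables (R : realType) (K n : nat).
Local Notation Y := (labelmx R K n).
Local Notation kstar := (class_kernel R K n).
Local Notation cls i := (mxtens_unindex i).1.

Lemma labelmxE (c : 'I_K) (i : 'I_(K * n)) : Y c i = (c == cls i)%:R.
Proof.
rewrite castmxE !mxE mulr1 cast_ord_id.
suff -> : cls (cast_ord (esym (muln1 K)) c) = c by [].
by apply: val_inj; rewrite /= divn1.
Qed.

Lemma class_kernelE (i j : 'I_(K * n)) : kstar i j = (cls i == cls j)%:R.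
Proof. by rewrite !mxE big_ord1 !mxE !mulr1. Qed.

Lemma class_kernel_labelmx : kstar = Y^T *m Y.
Proof.
apply/matrixP => i j; rewrite class_kernelE mxE (bigD1 (cls i)) //= big1 => [|c ci].
  by rewrite mxE !labelmxE eqxx mul1r addr0.
by rewrite mxE !labelmxE (negPf ci) mul0r.
Qed.

Lemma labelmx_mul_tr : Y *m Y^T = n%:R%:M.
Proof.
apply/matrixP => c d; rewrite !mxE.
(* The inserted factor [1] depends on the sample only, so [mulr_sum] splits the sum into one over
   classes times one over samples. *)
under eq_bigr => i _ do rewrite mxE !labelmxE -[X in X * _]mulr1 -mulrAC.
rewrite -(mulr_sum (fun e => (c == e)%:R * (d == e)%:R) (fun=> 1)).
rewrite (bigD1 c) //= big1 => [|e ec]; last by rewrite eq_sym (negPf ec) mul0r.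
by rewrite eqxx mul1r addr0 sumr_const card_ord mulr_natr mulrnAC mulrb eq_sym; case: eqP.
Qed.

Lemma labelmx_class_kernel : Y *m kstar = n%:R *: Y.
Proof. by rewrite class_kernel_labelmx mulmxA labelmx_mul_tr mul_scalar_mx. Qed.

Lemma class_kernel_sqr : kstar *m kstar = n%:R *: kstar.
Proof. by rewrite {1}class_kernel_labelmx -mulmxA labelmx_class_kernel -scalemxAr -class_kernel_labelmx. Qed.

Lemma feasible_class_kernel : feasible_kernel kstar.
Proof.
split=> [|i j|i]; rewrite ?class_kernelE ?ler0n ?eqxx //.
split=> [|x]; rewrite class_kernel_labelmx; first by rewrite trmx_mul trmxK.
rewrite mulmxA -trmx_mul -mulmxA mxE; apply: sumr_ge0 => c _.
by rewrite mxE -expr2 sqr_ge0.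
Qed.

(** The trace adds up the entries of [k] between samples of one class; each is at most [1], the
    value it has in [kstar]. *)
Lemma mxtrace_labelmx_le (k : 'M[R]_(K * n)) : feasible_kernel k ->
  \tr (Y *m k *m Y^T) <= \tr (Y *m kstar *m Y^T).
Proof.
move=> k_feas; have k_le1 := feasible_kernel_le1 k_feas.
have trE (M : 'M[R]_(K * n)) :
    \tr (Y *m M *m Y^T) = \sum_i \sum_j kstar i j * M j i.
  rewrite mxtrace_mulC mulmxA -class_kernel_labelmx.
  by apply: eq_bigr => i _; rewrite mxE.
rewrite !trE; apply: ler_sum => i _; apply: ler_sum => j _.
rewrite !class_kernelE; case: eqVneq => _; last by rewrite !mul0r.
by rewrite !mul1r.
Qed.

(* In the sum giving the entry [(i, j)] of [kstar (k - kstar)] all terms have the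
   same sign: nonpositive if [i] and [j] share a class, nonnegative otherwise. *)
Lemma feasible_kernel_unique (k : 'M[R]_(K * n)) : feasible_kernel k ->
  Y *m k = n%:R *: Y -> k = kstar.
Proof.
move=> k_feas Yk; have k_le1 := feasible_kernel_le1 k_feas.
case: k_feas => _ k_ge0 _.
have kstar_diff0 : kstar *m (k - kstar) = 0.
  rewrite mulmxBr class_kernel_sqr {1}class_kernel_labelmx -mulmxA Yk.
  by rewrite -scalemxAr -class_kernel_labelmx subrr.
have diffE a b : (k - kstar) a b = k a b - kstar a b.
  by rewrite mxE; congr (_ + _); rewrite mxE.
apply/matrixP => i j; set s : R := (-1) ^+ (cls i == cls j).
have term_ge0 l : 0 <= s * (kstar i l * (k l j - kstar l j)).
  rewrite /s !class_kernelE; have [<-|_] := eqVneq (cls i) (cls l); last first.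
    by rewrite mul0r mulr0.
  case: eqP => _; rewrite mul1r.
    by rewrite expr1 mulN1r opprB subr_ge0.
  by rewrite /= mul1r subr0 k_ge0.
have sum0 : \sum_l s * (kstar i l * (k l j - kstar l j)) = 0.
  rewrite -mulr_sumr -[RHS](mulr0 s); congr (_ * _).
  rewrite -[RHS](_ : (kstar *m (k - kstar)) i j = 0); last by rewrite kstar_diff0 mxE.
  by rewrite [RHS]mxE; apply: eq_bigr => l _; rewrite -diffE.
(* A vanishing sum of nonnegative terms has only zero terms. The term [l = i] has coefficient
   [kstar i i = 1], so it isolates the entry [(i, j)] of [k - kstar]. *)
have /psumr_eq0P/(_ sum0 i isT)/eqP := fun l (_ : true) => term_ge0 l.
by rewrite mulf_eq0 signr_eq0 /= class_kernelE eqxx mul1r subr_eq0 => /eqP.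
Qed.

End Labels.

Theorem theorem5p4 (R : realType) (K n : nat) (mu : R)
    (hK : (1 <= K)%N) (hn : (1 <= n)%N) (hmu : 0 < mu) :
  [/\ class_kernel R K n = (labelmx R K n)^T *m labelmx R K n,
      exists A : 'M[R]_(K, K * n),
        krr_optimal mu (labelmx R K n) A (class_kernel R K n)
    & forall (A : 'M[R]_(K, K * n)) (k : 'M[R]_(K * n)),
        krr_optimal mu (labelmx R K n) A k -> k = class_kernel R K n].
Proof.
set Y := labelmx R K n; set kstar := class_kernel R K n.
have kstar_feas : feasible_kernel kstar := feasible_class_kernel R K n.
(* As [Y *m kstar = n%:R *: Y], the first square vanishes at [(S, kstar)] when
   [1 - t * n - mu * t = 0], which dictates [t]. *)
set t := (n%:R + mu)^-1; set S : 'M[R]_(K, K * n) := t *: Y.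
have nmu_neq0 : n%:R + mu != 0 by rewrite gt_eqF // ltr_wpDl.
pose L (k : 'M[R]_(K * n)) := 2 * mu * \tr (Y *m S^T) - mu ^+ 2 * \tr (S *m S^T)
  - mu * \tr (S *m k *m S^T).
have L_min k : feasible_kernel k -> L kstar <= L k.
  move=> k_feas; rewrite /L lerD2l lerN2 ler_pM2l //.
  have trS M : \tr (S *m M *m S^T) = t ^+ 2 * \tr (Y *m M *m Y^T).
    by rewrite [S^T]linearZ /= -!scalemxAl -!scalemxAr !mxtraceZ expr2 mulrA.
  by rewrite !trS ler_wpM2l ?sqr_ge0 // mxtrace_labelmx_le.
have obj_ge A k : feasible_kernel k -> L k <= krr_objective mu Y A k.
  move=> [k_psd _ _]; rewrite (krr_objective_completed_square _ _ _ S) ?k_psd.1 //.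
  by rewrite lerDr addr_ge0 ?mxtrace_mul_tr_ge0 // mulr_ge0 ?(ltW hmu) ?(psdmx_mxtrace_ge0 k_psd).
have objS : krr_objective mu Y S kstar = L kstar.
  rewrite (krr_objective_completed_square _ _ _ S); last by case: kstar_feas => -[].
  have -> : Y - S *m kstar - mu *: S = 0.
    rewrite /S -scalemxAl labelmx_class_kernel !scalerA -{1}[Y]scale1r -!scalerBl.
    have -> : 1 - t * n%:R - mu * t = 0 by rewrite /t; field.
    by rewrite scale0r.
  by rewrite subrr !mul0mx !mxtrace0 mulr0 !add0r.
split=> [||A k [k_feas k_opt]]; first exact: class_kernel_labelmx.
  exists S; split=> // A k k_feas.
  by rewrite objS (le_trans (L_min k k_feas)) ?obj_ge.
apply: feasible_kernel_unique => //; rewrite -/Y.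
have k_psd : psdmx k by case: k_feas.
(* Comparing with [(S, kstar)] bounds the objective at [(A, k)] by [L kstar], hence by [L k]; so the
   two squares have sum at most [0]. *)
have := le_trans (k_opt S kstar kstar_feas); rewrite objS => /(_ _ (L_min k k_feas)).
rewrite (krr_objective_completed_square _ _ _ S) ?k_psd.1 // gerDr => le0.
have sq1 := mxtrace_mul_tr_ge0 (Y - A *m k - mu *: S).
have sq2 : 0 <= mu * \tr ((A - S) *m k *m (A - S)^T).
  by rewrite mulr_ge0 ?(ltW hmu) ?(psdmx_mxtrace_ge0 k_psd).
have /mxtrace_mul_tr_eq0/eqP : \tr ((Y - A *m k - mu *: S) *m (Y - A *m k - mu *: S)^T) = 0.
  lra.
have /eqP : mu * \tr ((A - S) *m k *m (A - S)^T) = 0 by lra.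
rewrite mulf_eq0 gt_eqF //= => /eqP/(psdmx_mxtrace_eq0 k_psd)/eqP.
(* Now [A *m k = S *m k], so the first square yields [t Y k = (1 - mu t) Y]; scaling by [n + mu]
   leaves [Y k = n Y]. *)
rewrite mulmxBl subr_eq0 => /eqP ->; rewrite subr_eq0 subr_eq addrC -subr_eq => /eqP.
rewrite /S scalerA -scalemxAl => /(congr1 (GRing.scale (n%:R + mu))).
rewrite !scalerA divff // scale1r => <-.
rewrite scalerBr scalerA -scalerBl; congr (_ *: _).
by rewrite /t; field.
Qed.
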